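(* Let $\Lambda\subset\mathbb{R}^d$ be a Meyer set, and let $k=\operatorname{ap-rank}(\Lambda)$. Then, for each $r,N\in\mathbb{N}$ there exists some $R>0$ such that, no matter how we colour $\Lambda$ with $r$ colours, for all $y\in\mathbb{R}^d$ the set $\Lambda\cap B_R(y)$ contains a monochromatic li-arithmetic progression of length $N$ and rank $k$.
   Context: Here $d\ge 1$ and $B_R(y)$ is the ball of radius $R$ centred at $y$. A set $\Lambda\subseteq\mathbb{R}^d$ is relatively dense if there is $R>0$ such that every ball $B_R(x)$, $x\in\mathbb{R}^d$, contains a point of $\Lambda$; it is uniformly discrete if there is $r>0$ such that every ball $B_r(x)$ contains at most one point of $\Lambda$. A Meyer set is a relatively dense set $\Lambda\subseteq\mathbb{R}^d$ such that $\Lambda-\Lambda$ is uniformly discrete. An li-arithmetic progression of length $N$ and rank $k$ is a set $\{s+c_1r_1+\dots+c_kr_k : c_j\in\mathbb{Z},\ 0\le c_j\le N\ \forall j\}$ with $s,r_1,\dots,r_k\in\mathbb{R}^d$ and $r_1,\dots,r_k$ linearly independent over $\mathbb{Z}$. The number $\operatorname{ap-rank}(\Lambda)$ is the largest $k\in\mathbb{N}$ such that for all $N\in\mathbb{N}$ there exists an li-arithmetic progression of length $N$ and rank $k$ contained in $\Lambda$. A subset is monochromatic if all its elements have the same colour. *)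

(* Defs.v *)
From HB Require Import structures.
From mathcomp Require Import all_boot all_order all_algebra.
From mathcomp Require Import boolp classical_sets reals topology.

Set Implicit Arguments.
Unset Strict Implicit.
Unset Printing Implicit Defensive.

Import Order.TTheory GRing.Theory Num.Theory.

Local Open Scope classical_set_scope.
Local Open Scope ring_scope.

(* The library's norm on 'rV[R]_d is the sup norm, hence this Euclidean one. *)
Definition enorm (R : realType) (d : nat) (x : 'rV[R]_d) : R :=
  Num.sqrt (\sum_(i < d) x ord0 i ^+ 2).

Definition eball (R : realType) (d : nat) (y : 'rV[R]_d) (rho : R) :
  set 'rV[R]_d := ball_ (@enorm R d) y rho.

Definition relatively_dense (R : realType) (d : nat) (L : set 'rV[R]_d) :=
  exists2 rho : R, 0 < rho & forall x, (L `&` eball x rho) !=set0.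

Definition uniformly_discrete (R : realType) (d : nat) (L : set 'rV[R]_d) :=
  exists2 rho : R, 0 < rho & forall x, is_subset1 (L `&` eball x rho).

Definition meyer_set (R : realType) (d : nat) (L : set 'rV[R]_d) :=
  relatively_dense L /\ uniformly_discrete [set x - y | x in L & y in L].

Definition Zindependent (V : zmodType) (k : nat) (v : 'I_k -> V) :=
  forall c : 'I_k -> int,
    \sum_(j < k) v j *~ c j = 0 -> forall j, c j = 0.

Definition li_progression (V : zmodType) (N k : nat) (A : set V) :=
  exists (s : V) (v : 'I_k -> V), Zindependent v /\
    A = [set s + \sum_(j < k) v j *+ c j | c in
           [set c : 'I_k -> nat | forall j, (c j <= N)%N]].

Definition has_li_progressions (V : zmodType) (L : set V) (k : nat) :=
  forall N : nat, exists2 A : set V, li_progression N k A & A `<=` L.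

(* A relation and not a function, since for an arbitrary L the ranks k with
   [has_li_progressions L k] need not have a maximum. *)
Definition is_ap_rank (V : zmodType) (L : set V) (k : nat) :=
  has_li_progressions L k /\
  forall m : nat, has_li_progressions L m -> (m <= k)%N.

Definition monochromatic (V C : Type) (f : V -> C) (A : set V) :=
  exists a : C, forall x, A x -> f x = a.

(* Main.v *)
Require Import Defs.
From mathcomp Require Import all_boot all_order all_algebra.
From mathcomp Require Import boolp classical_sets reals topology.
From mathcomp Require Import lra.

Local Open Scope classical_set_scope.
Local Open Scope ring_scope.

(** The proof combines Gallai's theorem with a rigidity property of Meyer sets.

    Write rho0 for a radius of relative density of L and eps for a radius of
    uniform discreteness of L - L.  Rigidity ([meyer_rigid]) says that two
    elements of L - L at distance less than eps are equal.

    Gallai's theorem ([gallai_grid]) turns a number of colours into a length M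
    such that every colouring of the grid {0..M}^k contains a monochromatic
    homothetic copy of {0..N}^k.  Since the rank k is attained at all lengths, L
    contains an li-progression s0 + comb u, with u in {0..M}^k.  This progression
    is chosen once and for all, but it may lie far from the ball in question; the
    point is to copy a part of it near any given y.

    Near each y + comb u, relative density provides a point lam u of L, with an
    error err u = y + comb u - lam u of norm less than rho0.  The ball of radius
    rho0 splits into finitely many cells of diameter less than eps
    ([eball_cells]); colour u by the cell of err u together with the colour of
    lam u.  Along a monochromatic copy of {0..N}^k the errors differ by less than
    eps, so lam u - lam u' and comb u - comb u', which both lie in L - L, are
    equal by rigidity.  Hence lam restricted to this copy is an exact translate
    of a progression with steps t times those of comb.  It lies in L, has a
    single colour, and stays at a distance from y that is bounded in terms of
    rho0 and of the size of the chosen progression only. *)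

Set Implicit Arguments.
Unset Strict Implicit.
Unset Printing Implicit Defensive.

Import Order.TTheory GRing.Theory Num.Theory.

(** * Gallai's theorem *)

Definition monochromatic_copy (V : nmodType) (C : Type) (col : V -> C)
    (F : seq V) (a : C) (w : V * nat) :=
  (0 < w.2)%N /\ forall x, x \in F -> col (w.1 + x *+ w.2) = a.

(** The list W encodes the finitary form of the statement: the homothety (its
    translation part and its ratio) is found among finitely many candidates
    fixed before the colouring, which is what bounds the size of the grid in
    [gallai_grid]. *)
Definition homothety_ramsey (V : nmodType) (F : seq V) :=
  forall C : finType, exists W : seq (V * nat), forall col : V -> C,
    exists2 w, w \in W & exists a, monochromatic_copy col F a w.

(** Colour focusing: either a copy of z :: F is monochromatic, or j copies of F
    are monochromatic in distinct colours and their extensions by z all send z to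
    the same point p, the focus.  To pass from j to j + 1, the property of F is
    applied to the colouring of V by the patterns of colours seen through a
    finite window X.  All the translates s + a t of the window, for a in F, then
    look alike, and the focused copies of one window can be stretched across
    them.  The focus p itself, which is repeated at each s + a t, yields a new
    copy of F.  If the colour of p is already taken, the corresponding copy of F
    extends to a monochromatic copy of z :: F. *)
Lemma color_focusing (V : nmodType) (z a0 : V) (F : seq V) (C : finType) :
  a0 \in F -> homothety_ramsey F ->
  forall j, exists (W : seq (V * nat)) (U : seq V), forall col : V -> C,
    (exists2 w, w \in W & exists a, monochromatic_copy col (z :: F) a w) \/
    (exists2 p, p \in U & exists2 T : {set C}, #|T| = j &
       forall c, c \in T -> exists2 w, w \in W &
         monochromatic_copy col F c w /\ w.1 + z *+ w.2 = p).
Proof.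
move=> a0F galF; elim=> [|j [W [U focus]]].
  exists [::], [:: 0] => col; right; exists 0; first by rewrite mem_head.
  by exists finset.set0; [rewrite cards0|move=> c; rewrite finset.in_set0].
(* The window has to contain the focus and all points of the focused copies. *)
pose X := U ++ [seq w.1 + a *+ w.2 | w <- W, a <- F].
have [W' W'P] := galF {ffun seq_sub X -> C}.
(* In order: copies found inside a single window, focused copies stretched across
   the windows, and the copy of F traced by the foci of the windows. *)
pose shifted := [seq (w'.1 + a0 *+ w'.2 + w.1, w.2) | w' <- W', w <- W].
pose summed := [seq (w'.1 + w.1, (w'.2 + w.2)%N) | w' <- W', w <- W].
pose new := [seq (w'.1 + p, w'.2) | w' <- W', p <- U].
exists (shifted ++ summed ++ new).
exists [seq w'.1 + z *+ w'.2 + p | w' <- W', p <- U] => col.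
have [[s t] stW' [g [/= t0 gP]]] :=
  W'P (fun v => [ffun u : seq_sub X => col (v + val u)]).
set v0 := s + a0 *+ t.
have colE a u : a \in F -> u \in X -> col (s + a *+ t + u) = col (v0 + u).
  move=> aF uX.
  have /ffunP/(_ (SeqSub uX)) : _ = _ := etrans (gP _ aF) (esym (gP _ a0F)).
  by rewrite !ffunE.
have lift_copy w c : w \in W ->
    monochromatic_copy (fun v => col (v0 + v)) (z :: F) c w ->
    exists2 w, w \in shifted ++ summed ++ new &
      exists a, monochromatic_copy col (z :: F) a w.
  move=> wW [w0 wc]; exists (v0 + w.1, w.2).
    by rewrite mem_cat; apply/orP; left; apply: (allpairs_f _ stW' wW).
  by exists c; split=> //= x xF; rewrite -addrA wc.
have [[w wW [c wc]]|[p pU [T Tj TP]]] := focus (fun v => col (v0 + v)).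
  by left; exact: lift_copy wc.
have [pT|pT] := boolP (col (v0 + p) \in T).
  have [w wW [[w0 wc] wp]] := TP _ pT.
  left; apply: (lift_copy w (col (v0 + p))) => //; split=> // x.
  rewrite inE => /predU1P[->|/wc//].
  by rewrite wp.
right; exists (s + z *+ t + p).
  exact: (allpairs_f (fun w p => w.1 + z *+ w.2 + p) stW' pU).
exists (col (v0 + p) |: T)%SET; first by rewrite cardsU1 pT Tj.
move=> c; rewrite in_setU1 => /predU1P[->|cT].
  exists (s + p, t); last first.
    split; last by rewrite /= addrAC.
    split=> //= a aF; rewrite addrAC colE// mem_cat; apply/orP; left; exact: pU.
  rewrite !mem_cat; apply/orP; right; apply/orP; right.
  exact: (allpairs_f (fun w p => (w.1 + p, w.2)) stW' pU).
have [w wW [[w0 wc] wp]] := TP _ cT.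
exists (s + w.1, (t + w.2)%N).
  rewrite !mem_cat; apply/orP; right; apply/orP; left.
  exact: (allpairs_f (fun w' w => (w'.1 + w.1, (w'.2 + w.2)%N)) stW' wW).
split; last by rewrite /= mulrnDr addrACA wp.
split=> /= [|a aF]; first by rewrite addn_gt0 t0.
rewrite mulrnDr addrACA colE ?wc// mem_cat; apply/orP; right.
exact: (allpairs_f (fun w a => w.1 + a *+ w.2) wW aF).
Qed.

(** Induction on F by colour focusing: more copies of F than there are colours
    cannot be monochromatic in distinct colours. *)
Lemma gallai (V : nmodType) (F : seq V) : homothety_ramsey F.
Proof.
elim: F => [|z [_|a0 F]].
- move=> C; exists [:: (0, 1%N)] => col; exists (0, 1%N); rewrite ?mem_head//.
  by exists (col 0); split.
- move=> C; exists [:: (0, 1%N)] => col; exists (0, 1%N); rewrite ?mem_head//.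
  exists (col z); split=> // x; rewrite inE => /eqP ->.
  by rewrite add0r.
- move=> galF C.
  have [W [U focus]] := color_focusing z C (mem_head _ _) galF #|C|.+1.
  exists W => col; have [//|[p _ [T TC _]]] := focus col.
  by have := max_card T; rewrite TC ltnn.
Qed.

Lemma gallai_grid (k N : nat) (C : finType) : exists M : nat,
  forall col : ('I_k -> nat) -> C, exists (s : 'I_k -> nat) (t : nat),
    [/\ (0 < t)%N, (forall j, s j + N * t <= M)%N &
      exists a, forall c : 'I_k -> nat, (forall j, c j <= N)%N ->
        col (fun j => s j + c j * t)%N = a].
Proof.
pose F : seq {ffun 'I_k -> nat} :=
  [seq [ffun j => nat_of_ord (g j)] | g : {ffun 'I_k -> 'I_N.+1}].
have [W WP] := gallai F C.
exists (\max_(w <- W) \max_(j < k) (w.1 j + N * w.2))%N => col.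
have [[s t] stW [a [/= t0 stP]]] := WP (fun u => col u).
exists s, t; split=> // [j|].
  apply: leq_trans (leq_bigmax_seq _ stW isT).
  exact: (leq_bigmax (F := fun j => s j + N * t)%N j).
exists a => c cN; rewrite -(stP [ffun j => c j]).
  by congr col; apply/funext => j; rewrite !ffunE ffunMnE ffunE -mulr_natr natn.
apply/mapP; exists [ffun j => inord (c j)]; first by rewrite mem_enum.
by apply/ffunP => j; rewrite !ffunE inordK// ltnS.
Qed.

(** * Euclidean balls and rigidity of Meyer sets *)

Section EuclideanNorm.
Context {R : realType} {d : nat}.
Implicit Types x : 'rV[R]_d.

Lemma coord_le_enorm x i : `|x ord0 i| <= enorm x.
Proof.
rewrite -sqrtr_sqr ler_wsqrtr// (bigD1 i)//= lerDl.
by apply: sumr_ge0 => j _; exact: sqr_ge0.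
Qed.

Lemma enorm_le x (b : R) : 0 <= b -> (forall i, `|x ord0 i| <= b) ->
  enorm x <= d%:R * b.
Proof.
move=> b0 xb; rewrite -[leRHS]ger0_norm ?mulr_ge0// -sqrtr_sqr ler_wsqrtr//.
apply: (@le_trans _ _ (\sum_(i < d) b ^+ 2)).
  by apply: ler_sum => i _; rewrite -real_normK ?num_real// lerXn2r// nnegrE.
rewrite sumr_const card_ord exprMn -[_ *+ d]mulr_natl ler_wpM2r ?sqr_ge0//.
by rewrite -natrX ler_nat; case: (d) => // n; rewrite expnS expn1 leq_pmulr.
Qed.

(** Total boundedness of balls, in the form of a finite colouring: a cell records
    the integer parts of the coordinates, after rescaling.  The divisor d + 1
    rather than d keeps the final inequality strict, also when d = 0. *)
Lemma eball_cells (rho eps : R) : 0 < eps ->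
  exists (C : finType) (cell : 'rV[R]_d -> C), forall x x',
    enorm x < rho -> enorm x' < rho -> cell x = cell x' -> enorm (x - x') < eps.
Proof.
move=> eps0; pose del := eps / d.+1%:R.
have del0 : 0 < del by rewrite divr_gt0.
pose idx (x : 'rV[R]_d) i := Num.truncn ((x ord0 i + rho) / del).
pose m := Num.truncn (2 * rho / del).
exists {ffun 'I_d -> 'I_m.+1}, (fun x => [ffun i => inord (idx x i)]) => x x' xr x'r.
have coord_ge0 (u : 'rV[R]_d) i : enorm u < rho -> 0 <= (u ord0 i + rho) / del.
  move=> /(le_lt_trans (coord_le_enorm u i)) /ltr_normlP[u1 u2].
  by rewrite divr_ge0 ?(ltW del0)// -lerBlDr sub0r lerNl ltW.
have idx_le (u : 'rV[R]_d) i : enorm u < rho -> (idx u i <= m)%N.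
  move=> ur; have /ltr_normlP[_ u2] := le_lt_trans (coord_le_enorm u i) ur.
  apply: le_truncn; rewrite ler_pM2r ?invr_gt0// mulr_natl mulr2n lerD2r.
  exact: ltW.
move=> /ffunP cellE.
apply: (@le_lt_trans _ _ (d%:R * del)).
  apply: enorm_le (ltW del0) _ => i.
  have := congr1 (@nat_of_ord _) (cellE i).
  rewrite !ffunE !inordK ?ltnS ?idx_le// => idxE.
  have := truncn_itv (coord_ge0 _ i xr); have := truncn_itv (coord_ge0 _ i x'r).
  rewrite -/(idx x i) -/(idx x' i) idxE -natr1.
  rewrite ler_pdivlMr// ltr_pdivrMr// => /andP[a1 a2].
  rewrite ler_pdivlMr// ltr_pdivrMr// => /andP[b1 b2].
  by rewrite !mxE ler_norml; lra.
by rewrite /del mulrCA gtr_pMr// ltr_pdivrMr// mul1r ltr_nat.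
Qed.

Lemma enorm0 : enorm (0 : 'rV[R]_d) = 0.
Proof. by rewrite /enorm big1 ?sqrtr0// => i _; rewrite mxE expr0n. Qed.

(** Both differences lie in the ball of radius eps centred at the first one. *)
Lemma meyer_rigid (L : set 'rV[R]_d) (eps : R) :
  (forall x, is_subset1 ([set a - b | a in L & b in L] `&` eball x eps)) ->
  forall a b a' b', L a -> L b -> L a' -> L b' ->
    enorm ((a - b) - (a' - b')) < eps -> a - b = a' - b'.
Proof.
move=> sep a b a' b' La Lb La' Lb' close; apply: (sep (a - b)).
  split; first by exists a => //; exists b.
  rewrite /eball /ball_ /= subrr enorm0.
  by apply: le_lt_trans close; exact: sqrtr_ge0.
by split=> //; exists a' => //; exists b'.
Qed.

End EuclideanNorm.

(** * Progressions *)

Lemma grid_bounded (R : realType) (d k M : nat) (v : 'I_k -> 'rV[R]_d) :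
  exists2 B : R, 0 <= B & forall u : 'I_k -> nat, (forall j, u j <= M)%N ->
    forall i, `|(\sum_(j < k) v j *+ u j) ord0 i| <= B.
Proof.
exists (\sum_(j < k) enorm (v j) *+ M).
  by apply: sumr_ge0 => j _; rewrite mulrn_wge0// sqrtr_ge0.
move=> u uM i; rewrite summxE; apply: le_trans (ler_norm_sum _ _ _) _.
apply: ler_sum => j _; rewrite mulmxnE normrMn.
apply: (@le_trans _ _ (enorm (v j) *+ u j)).
  by rewrite lerMn2r coord_le_enorm orbT.
by apply: ler_wpMn2l; rewrite ?sqrtr_ge0.
Qed.

Lemma Zindependent_scale (V : zmodType) (k t : nat) (v : 'I_k -> V) :
  (0 < t)%N -> Zindependent v -> Zindependent (fun j => v j *+ t).
Proof.
move=> t0 vfree c cv0 j.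
have /vfree/(_ j)/eqP : \sum_(j < k) v j *~ (t%:Z * c j) = 0.
  by rewrite -[RHS]cv0; apply: eq_bigr => i _; rewrite pmulrn -mulrzA.
by rewrite mulf_eq0 eqz_nat (gtn_eqF t0) => /eqP.
Qed.

Theorem theorem5p7 (R : realType) (d : nat) (hd : (1 <= d)%N)
  (L : set 'rV[R]_d) (hL : meyer_set L) (k : nat) (hk : is_ap_rank L k)
  (r N : nat) :
  exists2 rho : R, 0 < rho &
    forall f : 'rV[R]_d -> 'I_r, forall y : 'rV[R]_d,
      exists A : set 'rV[R]_d,
        [/\ li_progression N k A,
            A `<=` L `&` eball y rho &
            monochromatic f A].
Proof.
case: hL => [[rho0 rho0_gt0 dense] [eps eps_gt0 sep]].
have [C [cell cellP]] := eball_cells (d := d) rho0 eps_gt0.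
have [M gridP] := gallai_grid k N (C * 'I_r)%type.
have [P [s0 [v [vfree PE]]] PL] := hk.1 M.
pose comb (u : 'I_k -> nat) := \sum_(j < k) v j *+ u j.
have combL u : (forall j, u j <= M)%N -> L (s0 + comb u).
  by move=> uM; apply: PL; rewrite PE; exists u.
have [B B_ge0 combB] := grid_bounded M v.
have rB_ge0 : 0 <= rho0 + B by rewrite addr_ge0// ltW.
(* The points found below have coordinates within rho0 + B of those of y, and
   [enorm_le] costs a factor d. *)
exists (d%:R * (rho0 + B) + 1) => [|f y]; first by rewrite ltr_wpDl// mulr_ge0.
have near_point u : exists p, L p /\ enorm (y + comb u - p) < rho0.
  by have [p [Lp pE]] := dense (y + comb u); exists p.
have [lam lamP] := choice near_point.
pose err u := y + comb u - lam u.
have [s [t [t_gt0 stM [[e a] monoP]]]] := gridP (fun u => (cell (err u), f (lam u))).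
pose pt (c : 'I_k -> nat) j := (s j + c j * t)%N.
have ptM c : (forall j, c j <= N)%N -> forall j, (pt c j <= M)%N.
  by move=> cN j; apply: leq_trans (stM j); rewrite leq_add2l leq_mul2r cN orbT.
have combE c : comb (pt c) = comb s + \sum_(j < k) v j *+ t *+ c j.
  rewrite -big_split; apply: eq_bigr => j _.
  by rewrite mulrnDr -mulrnA mulnC.
have sE : pt (fun=> 0%N) = s by apply/funext => j; rewrite /pt mul0n addn0.
(* Rigidity: the approximations lam, along the monochromatic copy, move exactly
   as the original progression does. *)
have lamE c : (forall j, c j <= N)%N ->
    lam (pt c) = lam s + \sum_(j < k) v j *+ t *+ c j.
  move=> cN.
  have : (s0 + comb (pt c)) - (s0 + comb s) = lam (pt c) - lam s.
    apply: (meyer_rigid sep); [exact: combL (ptM _ cN)| | | |].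
    - by apply: combL; rewrite -sE; exact: ptM.
    - by have [] := lamP (pt c).
    - by have [] := lamP s.
    have -> : s0 + comb (pt c) - (s0 + comb s) - (lam (pt c) - lam s) =
        err (pt c) - err s.
      rewrite (addrC s0 (comb (pt c))) addrKA.
      rewrite /err -(addrA y (comb (pt c))) -(addrA y (comb s)).
      by rewrite (addrC y (_ - lam (pt c))) addrKA !opprD addrACA.
    apply: cellP; [by have [] := lamP (pt c)|by have [] := lamP s|].
    have := monoP c cN; have := monoP (fun=> 0%N) (fun=> leq0n _).
    by rewrite -!/(pt _) sE => -[-> _] [-> _].
  by rewrite combE (addrC s0) addrKA addrAC subrr add0r => ->; rewrite addrC subrK.
exists [set lam s + \sum_(j < k) v j *+ t *+ c j | c in
          [set c : 'I_k -> nat | forall j, (c j <= N)%N]].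
split.
- by exists (lam s), (fun j => v j *+ t); split=> //; exact: Zindependent_scale.
- move=> _ [c /= cN <-]; rewrite -lamE//; have [Llam lam_close] := lamP (pt c).
  split=> //; rewrite /eball /ball_ /=.
  apply: (@le_lt_trans _ _ (d%:R * (rho0 + B))); last by rewrite ltrDl.
  apply: enorm_le => // i.
  have -> : y - lam (pt c) = err (pt c) - comb (pt c).
    by rewrite /err addrAC addrK.
  rewrite !mxE; apply: le_trans (ler_normB _ _) _; apply: lerD.
    apply: ltW; apply: le_lt_trans lam_close.
    by have := coord_le_enorm (err (pt c)) i; rewrite !mxE.
  by apply: combB; exact: ptM.
- by exists a => _ [c /= cN <-]; rewrite -lamE//; have [] := monoP c cN.
Qed.
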